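(* Let $(\mathcal{M},I,\otimes)$ be a strict monoidal category and let $(\mathcal{C},\bullet)$ and $(\mathcal{D},\circ)$ be two strict left $\mathcal{M}$-actions. Consider the tower of opfibrations $$\mathbf{Para}(\circ)\times_{B\mathcal{M}}\mathbf{Para}(\bullet)\longrightarrow\mathbf{Para}(\bullet)\xrightarrow{P_\bullet}B\mathcal{M},$$ in which the first functor is the pullback of $P_\circ:\mathbf{Para}(\circ)\to B\mathcal{M}$ along $P_\bullet:\mathbf{Para}(\bullet)\to B\mathcal{M}$. Then its iterated dual produces preoptics: the iterated dual is a tower $$\mathbf{PreOptic}_{\mathcal{M}}(\bullet,\circ)\xrightarrow{\mathrm{view}}\mathbf{Para}(\bullet)^{\vee_{B\mathcal{M}}}\xrightarrow{P_\bullet^{\vee_{B\mathcal{M}}}}B\mathcal{M}$$ whose total category is that of preoptics for $\bullet$ and $\circ$, where a morphism from $(U,X)$ to $(V,Y)$ (with $U,V\in\mathcal{D}$ and $X,Y\in\mathcal{C}$) in the iterated dual consists of a residual $m\in\mathcal{M}$ (the part in $B\mathcal{M}$), a morphism $f:Y\to m\bullet X$ in $\mathcal{C}$ (the part in the fiber of $P_\bullet$), and a morphism $f^\sharp:m\circ U\to V$ in $\mathcal{D}$ (the part in the fiber of the top functor).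
   Context: A strict left $\mathcal{M}$-action on $\mathcal{C}$ is a functor $\bullet:\mathcal{M}\times\mathcal{C}\to\mathcal{C}$ with $I\bullet A=A$ and $M\bullet(N\bullet A)=(M\otimes N)\bullet A$. Preoptics: for $A,S\in\mathcal{C}$ and $B,T\in\mathcal{D}$, a preoptic $\binom{B}{A}\leftrightarrows\binom{T}{S}$ is a triple $(M,f,f^\sharp)$ where $M\in\mathcal{M}$ is called the residual, $f:A\to M\bullet S$ is a morphism in $\mathcal{C}$ called the view, and $f^\sharp:M\circ T\to B$ is a morphism in $\mathcal{D}$ called the update (no quotient is taken). The category of preoptics, written $\mathbf{PreOptic}_{\mathcal{M}}(\bullet,\circ)$, has as objects pairs of an object of $\mathcal{C}$ and an object of $\mathcal{D}$, and preoptics as morphisms. $\mathbf{Para}(\bullet)$ (only its 1-dimensional data is used) has the objects of $\mathcal{C}$, and its morphisms $X\to Y$ are the pairs $(m\in\mathcal{M},\ f:m\bullet X\to Y)$, composing in the obvious way. $B\mathcal{M}$ is the one-object category whose morphisms are the objects of $\mathcal{M}$, composed by $\otimes$. The functor $P_\bullet:\mathbf{Para}(\bullet)\to B\mathcal{M}$ sends $(m,f)$ to $m$; it is an opfibration, with opcartesian lift of $m$ at $X$ given by $(m,1_{m\bullet X}):X\to m\bullet X$. Similarly for $P_\circ:\mathbf{Para}(\circ)\to B\mathcal{M}$. Duals: for an opfibration $P:\mathcal{E}\to\mathcal{X}$ with chosen opcartesian lifts $E\to f_*E$, the dual $P^{\vee_{\mathcal{X}}}:\mathcal{E}^{\vee_{\mathcal{X}}}\to\mathcal{X}$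 is obtained by replacing each fiber by its opposite: it has the same objects as $\mathcal{E}$, and morphisms $E\to D$ are pairs $(f:P(E)\to P(D),\ \psi:D\to f_*E)$ with $\psi$ in the fiber over $P(D)$. The iterated dual of a tower $\mathcal{E}_2\to\mathcal{E}_1\to\mathcal{E}_0$ is obtained by first forming the dual $\mathcal{E}_2^{\vee_{\mathcal{E}_1}}\to\mathcal{E}_1$ over $\mathcal{E}_1$, and then taking the dual over $\mathcal{E}_0$ of this map, viewed as a map of opfibrations over $\mathcal{E}_0$; this gives a tower $(\mathcal{E}_2^{\vee_{\mathcal{E}_1}})^{\vee_{\mathcal{E}_0}}\to\mathcal{E}_1^{\vee_{\mathcal{E}_0}}\to\mathcal{E}_0$. *)

(* Defs.v *)
From Stdlib Require Import ProofIrrelevance IndefiniteDescription.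
From Corelib Require Import ssreflect ssrfun.

Set Implicit Arguments.
Unset Strict Implicit.
Unset Printing Implicit Defensive.

Declare Scope cat_scope.
Delimit Scope cat_scope with cat.
Open Scope cat_scope.

Local Obligation Tactic := idtac.

Record Category := {
  cob :> Type;
  hom : cob -> cob -> Type;
  idc : forall a, hom a a;
  comp : forall a b c, hom b c -> hom a b -> hom a c;
  comp1f : forall a b (f : hom a b), comp (idc b) f = f;
  compf1 : forall a b (f : hom a b), comp f (idc a) = f;
  compA : forall a b c d (h : hom c d) (g : hom b c) (f : hom a b),
    comp (comp h g) f = comp h (comp g f)
}.
Arguments hom {c} a b : rename.
Arguments idc {c} a : rename.
Arguments comp {c a b c0} g f : rename.

Notation "a ~> b" := (hom a b) (at level 70, no associativity) : cat_scope.
Notation "g ∘ f" := (comp g f) (at level 40, left associativity) : cat_scope.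

(** Strict structures involve equations between objects.  Such an equation
    [e : a = b] is used through the identity morphism [idto e : a ~> b], so that
    "[f] and [g] are equal" for arrows whose sources and targets are only
    provably equal reads [idto e' ∘ f = g ∘ idto e]. *)
Definition idto {C : Category} {a b : C} (e : a = b) : a ~> b :=
  match e in _ = b return a ~> b with eq_refl => idc a end.

Lemma idto1 (C : Category) (a : C) (e : a = a) : idto e = idc a.
Proof. by rewrite (proof_irrelevance _ e eq_refl). Qed.

Lemma idto_irr (C : Category) (a b : C) (e e' : a = b) : idto e = idto e'.
Proof. by rewrite (proof_irrelevance _ e e'). Qed.

Lemma idto_trans (C : Category) (a b c : C) (e' : b = c) (e : a = b) :
  idto e' ∘ idto e = idto (eq_trans e e').
Proof. by destruct e'; rewrite comp1f. Qed.

Lemma idtoK (C : Category) (a b : C) (e : a = b) (e' : b = a) :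
  idto e' ∘ idto e = idc a.
Proof. by rewrite idto_trans idto1. Qed.

Lemma idtoKA (C : Category) (a b c : C) (e : a = b) (e' : b = a) (f : c ~> a) :
  idto e' ∘ (idto e ∘ f) = f.
Proof. by rewrite -compA idtoK comp1f. Qed.

Lemma comp_congl (C : Category) (a b c : C) (g g' : b ~> c) (f : a ~> b) :
  g = g' -> g ∘ f = g' ∘ f.
Proof. by move=> ->. Qed.

Lemma comp_congr (C : Category) (a b c : C) (g : b ~> c) (f f' : a ~> b) :
  f = f' -> g ∘ f = g ∘ f'.
Proof. by move=> ->. Qed.

Record Functor (C D : Category) := {
  fob :> C -> D;
  fmap : forall a b : C, a ~> b -> fob a ~> fob b;
  fmap_id : forall a, fmap (idc a) = idc (fob a);
  fmap_comp : forall (a b c : C) (g : b ~> c) (f : a ~> b),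
    fmap (g ∘ f) = fmap g ∘ fmap f
}.
Arguments fmap {C D} F {a b} f : rename.

Lemma fmap_idto (C D : Category) (F : Functor C D) (a b : C) (e : a = b) :
  fmap F (idto e) = idto (f_equal F e).
Proof. by destruct e; rewrite fmap_id. Qed.

Definition functor_id (C : Category) : Functor C C :=
  {| fob := fun a => a; fmap := fun a b f => f;
     fmap_id := fun a => erefl; fmap_comp := fun a b c g f => erefl |}.

Program Definition functor_comp (A B C : Category)
    (G : Functor B C) (F : Functor A B) : Functor A C :=
  {| fob := fun a => G (F a); fmap := fun a b f => fmap G (fmap F f) |}.
Next Obligation. by move=> * /=; rewrite !fmap_id. Qed.
Next Obligation. by move=> * /=; rewrite !fmap_comp. Qed.
Notation "G ∘F F" := (functor_comp G F) (at level 40, left associativity) : cat_scope.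

Definition is_isomorphism (C D : Category) (F : Functor C D) : Prop :=
  exists G : Functor D C, G ∘F F = functor_id C /\ F ∘F G = functor_id D.

Program Definition prod_cat (C D : Category) : Category :=
  {| cob := C * D;
     hom := fun a b => ((a.1 ~> b.1) * (a.2 ~> b.2))%type;
     idc := fun a => (idc a.1, idc a.2);
     comp := fun a b c g f => (g.1 ∘ f.1, g.2 ∘ f.2) |}.
Next Obligation. by move=> C D a b [f g] /=; rewrite !comp1f. Qed.
Next Obligation. by move=> C D a b [f g] /=; rewrite !compf1. Qed.
Next Obligation. by move=> * /=; rewrite !compA. Qed.

Definition opcartesian (E X : Category) (P : Functor E X) (a b : E) (phi : a ~> b)
    : Prop :=
  forall (c : E) (k : a ~> c) (u : P b ~> P c), u ∘ fmap P phi = fmap P k ->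
    exists! t : b ~> c, fmap P t = u /\ t ∘ phi = k.

Record Opfibration (E X : Category) (P : Functor E X) := {
  push : forall (a : E) (y : X), P a ~> y -> E;
  push_eq : forall (a : E) (y : X) (f : P a ~> y), P (push f) = y;
  lift : forall (a : E) (y : X) (f : P a ~> y), a ~> push f;
  lift_over : forall (a : E) (y : X) (f : P a ~> y),
    idto (push_eq f) ∘ fmap P (lift f) = f;
  lift_opcartesian : forall (a : E) (y : X) (f : P a ~> y), opcartesian P (lift f)
}.
Arguments push {E X P} O a {y} f : rename.
Arguments push_eq {E X P} O a {y} f : rename.
Arguments lift {E X P} O a {y} f : rename.
Arguments lift_over {E X P} O [a y] f : rename.
Arguments lift_opcartesian {E X P} O [a y] f : rename.

Section Factorization.
Variables (E X : Category) (P : Functor E X).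

Definition factor (a b : E) (phi : a ~> b) (H : opcartesian P phi)
    (c : E) (k : a ~> c) (u : P b ~> P c) (Hu : u ∘ fmap P phi = fmap P k) : b ~> c :=
  proj1_sig (constructive_indefinite_description _ (H c k u Hu)).

Lemma factor_over a b (phi : a ~> b) (H : opcartesian P phi) c (k : a ~> c) u Hu :
  fmap P (factor H (k := k) (u := u) Hu) = u.
Proof. by rewrite /factor; case: constructive_indefinite_description => t [[]]. Qed.

Lemma factor_comp a b (phi : a ~> b) (H : opcartesian P phi) c (k : a ~> c) u Hu :
  factor H (k := k) (u := u) Hu ∘ phi = k.
Proof. by rewrite /factor; case: constructive_indefinite_description => t [[]]. Qed.

Lemma opcart_uniq a b (phi : a ~> b) (H : opcartesian P phi) c (t t' : b ~> c) :
  fmap P t = fmap P t' -> t ∘ phi = t' ∘ phi -> t = t'.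
Proof.
move=> e1 e2; case: (H c (t ∘ phi) (fmap P t)); first by rewrite fmap_comp.
by move=> s [_ Hs]; rewrite -(Hs t) // -(Hs t').
Qed.

Lemma opcart_comp_iso a b c (phi : a ~> b) (t : b ~> c) (s : c ~> b) :
  s ∘ t = idc b -> t ∘ s = idc c -> opcartesian P phi -> opcartesian P (t ∘ phi).
Proof.
move=> st ts H d k u Hu.
have Hu' : (u ∘ fmap P t) ∘ fmap P phi = fmap P k by rewrite -Hu fmap_comp compA.
case: (H d k _ Hu') => w [[w1 w2] Hw]; exists (w ∘ s); split.
  split; first by rewrite fmap_comp w1 compA -fmap_comp ts fmap_id compf1.
  by rewrite compA -(compA s) st comp1f.
move=> w' [w1' w2']; have -> : w = w' ∘ t.
  by apply: Hw; split; [rewrite fmap_comp w1' | rewrite compA].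
by rewrite compA ts compf1.
Qed.

Variable O : Opfibration P.

Lemma lift_over' a y (f : P a ~> y) (e : y = P (push O a f)) :
  fmap P (lift O a f) = idto e ∘ f.
Proof. by rewrite -[RHS](f_equal (comp (idto e)) (lift_over O f)) idtoKA. Qed.

(** The arrow [f_* a ~> (g ∘ f)_* a] over [g]. *)
Definition push_comparison a y z (g : y ~> z) (f : P a ~> y) :
    push O a f ~> push O a (g ∘ f).
Proof.
refine (factor (lift_opcartesian O f) (k := lift O a (g ∘ f))
         (u := idto (esym (push_eq O a (g ∘ f))) ∘ g ∘ idto (push_eq O a f)) _).
by rewrite compA (lift_over O) compA -lift_over'.
Defined.

Lemma push_comparison_over a y z (g : y ~> z) (f : P a ~> y) :
  fmap P (push_comparison g f) =
  idto (esym (push_eq O a (g ∘ f))) ∘ g ∘ idto (push_eq O a f).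
Proof. exact: factor_over. Qed.

Lemma push_comparison_lift a y z (g : y ~> z) (f : P a ~> y) :
  push_comparison g f ∘ lift O a f = lift O a (g ∘ f).
Proof. exact: factor_comp. Qed.

End Factorization.

Section Dual.
Variables (E X : Category) (P : Functor E X) (O : Opfibration P).

(** A morphism from [a] to [b] in the dual; [dfib_vert] says that its second
    component is in the fiber over [P b], which is where [f_* a] lives up to
    the equation [push_eq]. *)
Record dual_hom (a b : E) := DualHom {
  dbase : P a ~> P b;
  dfib : b ~> push O a dbase;
  dfib_vert : idto (push_eq O a dbase) ∘ fmap P dfib = idc (P b)
}.

(** The reindexing [g_* psi : g_* b ~> g_* (f_* a) ≅ (g ∘ f)_* a] of a vertical
    arrow [psi : b ~> f_* a]. *)
Definition push_vert (a b : E) (p : dual_hom a b) (z : X) (g : P b ~> z) :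
  push O b g ~> push O a (g ∘ dbase p).
Proof.
refine (factor (lift_opcartesian O g)
         (k := push_comparison O g (dbase p) ∘ dfib p)
         (u := idto (esym (push_eq O a (g ∘ dbase p))) ∘ idto (push_eq O b g)) _).
by rewrite compA (lift_over O) fmap_comp push_comparison_over !compA
           (dfib_vert p) compf1.
Defined.

Lemma push_vert_over a b (p : dual_hom a b) z (g : P b ~> z) :
  fmap P (push_vert p g) =
  idto (esym (push_eq O a (g ∘ dbase p))) ∘ idto (push_eq O b g).
Proof. exact: factor_over. Qed.

Lemma push_vert_lift a b (p : dual_hom a b) z (g : P b ~> z) :
  push_vert p g ∘ lift O b g = push_comparison O g (dbase p) ∘ dfib p.
Proof. exact: factor_comp. Qed.

Definition dual_id (a : E) : dual_hom a a :=
  @DualHom a a (idc (P a)) (lift O a (idc (P a))) (lift_over O _).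

Definition dual_comp (a b c : E) (q : dual_hom b c) (p : dual_hom a b) : dual_hom a c.
Proof.
refine (@DualHom a c (dbase q ∘ dbase p) (push_vert p (dbase q) ∘ dfib q) _).
by rewrite fmap_comp push_vert_over !compA idtoKA (dfib_vert q).
Defined.

Lemma dual_hom_ext (a b : E) (p q : dual_hom a b) : dbase p = dbase q ->
  (forall t : push O a (dbase p) ~> push O a (dbase q),
     t ∘ lift O a (dbase p) = lift O a (dbase q) ->
     fmap P t = idto (esym (push_eq O a (dbase q))) ∘ idto (push_eq O a (dbase p)) ->
     t ∘ dfib p = dfib q) -> p = q.
Proof.
case: p q => f psi H [f' psi' H'] /= e; destruct e => Ht.
have e : psi = psi'.
  rewrite -(Ht (idc _)) ?comp1f //.
  by rewrite fmap_id idtoK.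
by destruct e; rewrite (proof_irrelevance _ H H').
Qed.

Lemma dfib_inj (a b : E) (f : P a ~> P b) (psi psi' : b ~> push O a f) H H' :
  DualHom (dbase := f) (dfib := psi) H = DualHom (dbase := f) (dfib := psi') H' ->
  psi = psi'.
Proof.
move=> /(f_equal (fun p => existT (fun f => b ~> push O a f) (dbase p) (dfib p))) /=.
exact: ProofIrrelevanceTheory.EqdepTheory.inj_pair2.
Qed.

Lemma dual_comp1f (a b : E) (p : dual_hom a b) : dual_comp (dual_id b) p = p.
Proof.
apply: dual_hom_ext => /=; first exact: comp1f.
move=> t tl tP; rewrite push_vert_lift -!compA -[RHS]comp1f; congr (_ ∘ _).
apply: (opcart_uniq (lift_opcartesian O (dbase p))).
  by rewrite fmap_comp tP push_comparison_over fmap_id compf1 !compA !idtoKA idtoK.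
by rewrite compA push_comparison_lift tl comp1f.
Qed.

Lemma dual_compf1 (a b : E) (p : dual_hom a b) : dual_comp p (dual_id a) = p.
Proof.
apply: dual_hom_ext => /=; first exact: compf1.
move=> t tl tP; rewrite -!compA -[RHS]comp1f; congr (_ ∘ _).
apply: (opcart_uniq (lift_opcartesian O (dbase p))).
  by rewrite fmap_comp tP (push_vert_over (dual_id a)) fmap_id !compA !idtoKA idtoK.
by rewrite compA (push_vert_lift (dual_id a)) /= push_comparison_lift tl comp1f.
Qed.

Lemma dual_compA (a b c d : E) (r : dual_hom c d) (q : dual_hom b c) (p : dual_hom a b) :
  dual_comp (dual_comp r q) p = dual_comp r (dual_comp q p).
Proof.
symmetry; apply: dual_hom_ext => /=; first by rewrite compA.
move=> t tl tP; rewrite -[LHS]compA -[RHS]compA; apply: comp_congl.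
apply: (opcart_uniq (lift_opcartesian O (dbase r))).
  by rewrite !fmap_comp tP (push_vert_over (dual_comp q p)) !push_vert_over !compA !idtoKA.
rewrite [LHS]compA [RHS]compA (push_vert_lift (dual_comp q p)) push_vert_lift /=.
rewrite -[LHS]compA -[LHS]compA -[RHS]compA; apply: comp_congl.
apply: (opcart_uniq (lift_opcartesian O (dbase q))).
  rewrite !fmap_comp tP push_comparison_over (push_comparison_over O (dbase r)).
  by rewrite !push_vert_over !compA !idtoKA.
rewrite [LHS]compA push_vert_lift [RHS]compA push_comparison_lift.
rewrite (push_vert_lift p (dbase r ∘ dbase q)) -[LHS]compA; apply: comp_congl.
apply: (opcart_uniq (lift_opcartesian O (dbase p))).
  by rewrite !fmap_comp tP !push_comparison_over !compA !idtoKA.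
rewrite [LHS]compA push_comparison_lift [LHS]compA.
by rewrite (push_comparison_lift O (dbase r) (dbase q ∘ dbase p)) tl push_comparison_lift.
Qed.

Definition dual : Category :=
  {| cob := E; hom := dual_hom; idc := dual_id; comp := dual_comp;
     comp1f := dual_comp1f; compf1 := dual_compf1; compA := dual_compA |}.

Definition dual_proj : Functor dual X :=
  {| fob := fun a : dual => P a; fmap := @dbase;
     fmap_id := fun a => erefl; fmap_comp := fun a b c g f => erefl |}.

(** The chosen lift of [f] in the dual is [(f, 1_{f_* a})], up to the equation
    [P (f_* a) = y]. *)
Definition dual_lift (a : E) (y : X) (f : P a ~> y) : dual_hom a (push O a f).
Proof.
refine (@DualHom a (push O a f) (idto (esym (push_eq O a f)) ∘ f)
          (push_comparison O (idto (esym (push_eq O a f))) f) _).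
by rewrite push_comparison_over !compA idtoKA idtoK.
Defined.

Lemma dual_lift_over (a : E) (y : X) (f : P a ~> y) :
  idto (push_eq O a f) ∘ fmap dual_proj (dual_lift f : hom (c := dual) _ _) = f.
Proof. by rewrite /= idtoKA. Qed.

Lemma dual_lift_opcartesian (a : E) (y : X) (f : P a ~> y) :
  opcartesian dual_proj (dual_lift f : hom (c := dual) _ _).
Proof.
move=> c k u /= Hu.
set e := esym (push_eq O a f) in Hu *.
set d := dual_lift f.
have Hc : (idto (esym (push_eq O (push O a f) u)) ∘ idto (push_eq O a (u ∘ dbase d)))
          ∘ fmap P (lift O a (u ∘ dbase d))
          = fmap P (lift O (push O a f) u ∘ lift O a f).
  rewrite compA (lift_over O) fmap_comp.
  rewrite (lift_over' (esym (push_eq O (push O a f) u))).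
  by rewrite (lift_over' e) !compA.
pose i := factor (lift_opcartesian O (u ∘ dbase d)) Hc.
have iP : fmap P i = _ := factor_over _ _.
have il : i ∘ lift O a (u ∘ dbase d) = _ := factor_comp _ _.
have wi : push_vert d u ∘ i = idc _.
  apply: (opcart_uniq (lift_opcartesian O (u ∘ dbase d))).
    by rewrite fmap_comp iP push_vert_over fmap_id !compA !idtoKA idtoK.
  rewrite compA il -compA push_vert_lift /= comp1f compA !push_comparison_lift.
  by [].
have iw : i ∘ push_vert d u = idc _.
  apply: (opcart_uniq (lift_opcartesian O u)).
    by rewrite fmap_comp iP push_vert_over fmap_id !compA !idtoKA idtoK.
  rewrite compA push_vert_lift comp1f.
  apply: (opcart_uniq (lift_opcartesian O f)).
    rewrite !fmap_comp iP !push_comparison_over.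
    rewrite (lift_over' (esym (push_eq O (push O a f) u))) /=.
    by rewrite !compA !idtoKA idtoK compf1.
  by rewrite /= !compA !push_comparison_lift il.
case: k Hu => /= g chi Hchi Hu; destruct Hu.
have Hv : idto (push_eq O (push O a f) u) ∘ fmap P (i ∘ chi) = idc (P c).
  by rewrite fmap_comp iP !compA idtoKA.
exists (DualHom Hv); split.
  split=> //; apply: dual_hom_ext => //= t tl tP.
  have -> : t = idc _.
    apply: (opcart_uniq (lift_opcartesian O (u ∘ dbase d))).
      by rewrite tP fmap_id idtoK.
    by rewrite comp1f.
  by rewrite comp1f -[LHS]compA wi comp1f.
move=> [u' xi Hxi] /= [eu ek]; destruct eu.
apply: dual_hom_ext => //= t tl tP.
have -> : t = idc _.
  apply: (opcart_uniq (lift_opcartesian O u')).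
    by rewrite tP fmap_id idtoK.
  by rewrite comp1f.
have -> : chi = push_vert d u' ∘ xi.
  exact: (dfib_inj (esym ek)).
by rewrite comp1f -[LHS]compA iw comp1f.
Qed.

Definition dual_opfibration : Opfibration dual_proj :=
  @Build_Opfibration dual X dual_proj (push O) (push_eq O)
    dual_lift dual_lift_over dual_lift_opcartesian.

End Dual.
Arguments DualHom {E X P O a b} dbase dfib dfib_vert.

Section Towers.
Variables (E2 E1 E0 : Category) (Q : Functor E2 E1) (P : Functor E1 E0).

Lemma opcartesian_comp (a b : E2) (phi : a ~> b) :
  opcartesian Q phi -> opcartesian P (fmap Q phi) -> opcartesian (P ∘F Q) phi.
Proof.
move=> HQ HP c k u /= Hu.
case: (HP _ (fmap Q k) u Hu) => v [[v1 v2] Hv].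
case: (HQ _ k v v2) => t [[t1 t2] Ht]; exists t; split; first by rewrite /= t1.
move=> t' [/= t1' t2']; apply: Ht; split=> //; symmetry; apply: Hv.
by rewrite t1' -fmap_comp t2'.
Qed.

Lemma opcartesian_idto (a b c : E1) (phi : a ~> b) (e : b = c) :
  opcartesian P phi -> opcartesian P (idto e ∘ phi).
Proof. by destruct e; rewrite comp1f. Qed.

Variables (OQ : Opfibration Q) (OP : Opfibration P).

Definition comp_push (a : E2) (y : E0) (f : P (Q a) ~> y) : E2 :=
  push OQ a (lift OP (Q a) f).

Lemma comp_push_eq (a : E2) (y : E0) (f : P (Q a) ~> y) : P (Q (comp_push f)) = y.
Proof. by rewrite (push_eq OQ) (push_eq OP). Qed.

Definition comp_lift (a : E2) (y : E0) (f : P (Q a) ~> y) : a ~> comp_push f :=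
  lift OQ a (lift OP (Q a) f).

Lemma comp_lift_over (a : E2) (y : E0) (f : P (Q a) ~> y) :
  idto (comp_push_eq f) ∘ fmap (P ∘F Q) (comp_lift f) = f.
Proof.
rewrite /= /comp_lift.
rewrite (lift_over' (esym (push_eq OQ a (lift OP (Q a) f)))) fmap_comp fmap_idto.
rewrite -compA idto_trans -[RHS](lift_over OP); apply: comp_congl.
exact: idto_irr.
Qed.

Lemma comp_lift_opcartesian (a : E2) (y : E0) (f : P (Q a) ~> y) :
  opcartesian (P ∘F Q) (comp_lift f).
Proof.
apply: opcartesian_comp; first exact: lift_opcartesian.
rewrite (lift_over' (esym (push_eq OQ a (lift OP (Q a) f)))).
by apply: opcartesian_idto; apply: lift_opcartesian.
Qed.

Definition comp_opfibration : Opfibration (P ∘F Q) :=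
  @Build_Opfibration E2 E0 (P ∘F Q) comp_push comp_push_eq comp_lift
    comp_lift_over comp_lift_opcartesian.

End Towers.

(** [H] is a map of opfibrations from [P ∘F H] to [P] over the base of [P]. *)
Definition preserves_opcartesian (E E' X : Category)
    (H : Functor E E') (P : Functor E' X) : Prop :=
  forall (a b : E) (phi : a ~> b),
    opcartesian (P ∘F H) phi -> opcartesian P (fmap H phi).

Lemma comp_opfibration_map (E2 E1 E0 : Category) (Q : Functor E2 E1) (P : Functor E1 E0)
  (OQ : Opfibration Q) (OP : Opfibration P) : preserves_opcartesian Q P.
Proof.
move=> a b phi Hphi.
set O := comp_opfibration OQ OP.
pose f := fmap (P ∘F Q) phi.
have Hl := lift_opcartesian O f.
have e1 : idto (esym (push_eq O a f)) ∘ fmap (P ∘F Q) phi = fmap (P ∘F Q) (lift O a f).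
  by rewrite [RHS](lift_over' (esym (push_eq O a f))).
have e2 : idto (push_eq O a f) ∘ fmap (P ∘F Q) (lift O a f) = fmap (P ∘F Q) phi.
  exact: lift_over.
pose s := factor Hphi e1; pose t := factor Hl e2.
have st : s ∘ t = idc _.
  apply: (opcart_uniq Hl); last by rewrite compA !factor_comp comp1f.
  by rewrite [LHS]fmap_comp !factor_over fmap_id idtoK.
have ts : t ∘ s = idc _.
  apply: (opcart_uniq Hphi); last by rewrite compA !factor_comp comp1f.
  by rewrite [LHS]fmap_comp !factor_over fmap_id idtoK.
have -> : phi = t ∘ lift O a f by rewrite factor_comp.
rewrite fmap_comp; apply: (opcart_comp_iso (s := fmap Q s)).
- by rewrite -fmap_comp st fmap_id.
- by rewrite -fmap_comp ts fmap_id.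
- rewrite /O /= /comp_lift (lift_over' (esym (push_eq OQ a (lift OP (Q a) f)))).
  by apply: opcartesian_idto; apply: lift_opcartesian.
Qed.

Section DualMap.
Variables (E E' X : Category) (H : Functor E E') (P : Functor E' X).
Variables (O : Opfibration (P ∘F H)) (O' : Opfibration P).
Hypothesis (HH : preserves_opcartesian H P).

(** The canonical arrow [H (f_* a) ~> f_* (H a)]. *)
Definition map_push (a : E) (y : X) (f : P (H a) ~> y) :
  H (push O a f) ~> push O' (H a) f.
Proof.
refine (factor (HH (lift_opcartesian O f)) (k := lift O' (H a) f)
          (u := idto (esym (push_eq O' (H a) f)) ∘ idto (push_eq O a f)) _).
by rewrite compA (lift_over O f) [RHS](lift_over' (esym (push_eq O' (H a) f))).
Defined.

Lemma map_push_over (a : E) (y : X) (f : P (H a) ~> y) :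
  fmap P (map_push f) = idto (esym (push_eq O' (H a) f)) ∘ idto (push_eq O a f).
Proof. exact: factor_over. Qed.

Lemma map_push_lift (a : E) (y : X) (f : P (H a) ~> y) :
  map_push f ∘ fmap H (lift O a f) = lift O' (H a) f.
Proof. exact: factor_comp. Qed.

Definition dual_map_hom (a b : dual O) (p : a ~> b) : hom (c := dual O') (H a) (H b).
Proof.
refine (DualHom (O := O') (a := H a) (b := H b)
          (dbase p) (map_push (dbase p) ∘ fmap H (dfib p)) _).
rewrite fmap_comp map_push_over !compA idtoKA.
exact: (dfib_vert p).
Defined.

Lemma dual_map_id (a : dual O) : dual_map_hom (idc a) = idc (H a : dual O').
Proof.
apply: dual_hom_ext => [|t tl tP] /=; first by [].
by rewrite map_push_lift tl.
Qed.

Lemma dual_map_comp (a b c : dual O) (q : b ~> c) (p : a ~> b) :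
  dual_map_hom (q ∘ p) = dual_map_hom q ∘ dual_map_hom p.
Proof.
apply: dual_hom_ext => [|t tl tP] //=.
have -> : t = idc _.
  apply: (opcart_uniq (lift_opcartesian O' (dbase q ∘ dbase p))).
    by rewrite tP idtoK fmap_id.
  by rewrite comp1f.
rewrite comp1f fmap_comp -[LHS]compA -[RHS]compA; apply: comp_congl.
apply: (opcart_uniq (HH (lift_opcartesian O (dbase q)))).
  rewrite [LHS]fmap_comp [RHS]fmap_comp !map_push_over.
  rewrite (push_vert_over (dual_map_hom p)).
  by rewrite [fmap P (fmap H _)](push_vert_over p) !compA !idtoKA.
rewrite [LHS]compA -fmap_comp push_vert_lift fmap_comp [RHS]compA map_push_lift.
rewrite (push_vert_lift (dual_map_hom p)) /= -[LHS]compA -[RHS]compA; apply: comp_congl.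
apply: (opcart_uniq (HH (lift_opcartesian O (dbase p)))).
  rewrite [LHS]fmap_comp [RHS]fmap_comp !map_push_over push_comparison_over.
  by rewrite [fmap P (fmap H _)](push_comparison_over O) !compA !idtoKA.
rewrite [LHS]compA -fmap_comp push_comparison_lift map_push_lift.
by rewrite [RHS]compA map_push_lift push_comparison_lift.
Qed.

Definition dual_map : Functor (dual O) (dual O') :=
  {| fob := fun a : dual O => H a : dual O'; fmap := dual_map_hom;
     fmap_id := dual_map_id; fmap_comp := dual_map_comp |}.

End DualMap.

Section IteratedDual.
Variables (E2 E1 E0 : Category) (Q : Functor E2 E1) (P : Functor E1 E0).
Variables (OQ : Opfibration Q) (OP : Opfibration P).

(** The dual of [Q] over [E1] is an opfibration over [E1]; composing with [P]
    makes its total category opfibered over [E0], and [dual_proj OQ] a map of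
    opfibrations to [P].  The second dual is that of this map, over [E0]. *)
Definition iter_opfibration : Opfibration (P ∘F dual_proj OQ) :=
  comp_opfibration (dual_opfibration OQ) OP.

Definition iter_dual : Category := dual iter_opfibration.

Definition iter_dual_top : Functor iter_dual (dual OP) :=
  dual_map iter_opfibration OP
    (comp_opfibration_map (dual_opfibration OQ) OP).

Definition iter_dual_bottom : Functor (dual OP) E0 := dual_proj OP.

End IteratedDual.

Section Pullback.
Variables (A B X : Category) (P : Functor A X) (Q : Functor B X).

Record pb_ob := PbOb { pb_fst : A; pb_snd : B; pb_eq : P pb_fst = Q pb_snd }.

Record pb_hom (a b : pb_ob) := PbHom {
  pb_fst_hom : pb_fst a ~> pb_fst b;
  pb_snd_hom : pb_snd a ~> pb_snd b;
  pb_hom_eq : idto (pb_eq b) ∘ fmap P pb_fst_hom = fmap Q pb_snd_hom ∘ idto (pb_eq a)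
}.

Lemma pb_hom_ext (a b : pb_ob) (f g : pb_hom a b) :
  pb_fst_hom f = pb_fst_hom g -> pb_snd_hom f = pb_snd_hom g -> f = g.
Proof.
case: f g => [f1 f2 Hf] [g1 g2 Hg] /= e1 e2; destruct e1, e2.
by rewrite (proof_irrelevance _ Hf Hg).
Qed.

Definition pb_id (a : pb_ob) : pb_hom a a.
Proof.
refine (@PbHom a a (idc _) (idc _) _).
by rewrite !fmap_id comp1f compf1.
Defined.

Definition pb_comp (a b c : pb_ob) (g : pb_hom b c) (f : pb_hom a b) : pb_hom a c.
Proof.
refine (@PbHom a c (pb_fst_hom g ∘ pb_fst_hom f) (pb_snd_hom g ∘ pb_snd_hom f) _).
by rewrite !fmap_comp -compA pb_hom_eq !compA pb_hom_eq.
Defined.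

Program Definition pullback : Category :=
  {| cob := pb_ob; hom := pb_hom; idc := pb_id; comp := pb_comp |}.
Next Obligation. by move=> a b f; apply: pb_hom_ext; rewrite /= comp1f. Qed.
Next Obligation. by move=> a b f; apply: pb_hom_ext; rewrite /= compf1. Qed.
Next Obligation. by move=> a b c d h g f; apply: pb_hom_ext; rewrite /= compA. Qed.

Definition pb_proj : Functor pullback B :=
  {| fob := fun a : pullback => pb_snd a; fmap := fun a b f => pb_snd_hom f;
     fmap_id := fun a => erefl; fmap_comp := fun a b c g f => erefl |}.

Variable O : Opfibration P.

Definition pb_push (a : pullback) (y : B) (g : pb_proj a ~> y) : pullback :=
  PbOb (push_eq O (pb_fst a) (fmap Q g ∘ idto (pb_eq a))).

Definition pb_lift (a : pullback) (y : B) (g : pb_proj a ~> y) : a ~> pb_push g :=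
  @PbHom a (pb_push g) (lift O (pb_fst a) (fmap Q g ∘ idto (pb_eq a))) g
    (lift_over O (fmap Q g ∘ idto (pb_eq a))).

Lemma pb_lift_over (a : pullback) (y : B) (g : pb_proj a ~> y) :
  idto (erefl : pb_proj (pb_push g) = y) ∘ fmap pb_proj (pb_lift g) = g.
Proof. exact: comp1f. Qed.

Lemma pb_lift_opcartesian (a : pullback) (y : B) (g : pb_proj a ~> y) :
  opcartesian pb_proj (pb_lift g).
Proof.
move=> c k u /= Hu.
set f := fmap Q g ∘ idto (pb_eq a).
have Hf : (idto (esym (pb_eq c)) ∘ fmap Q u ∘ idto (push_eq O (pb_fst a) f))
          ∘ fmap P (lift O (pb_fst a) f) = fmap P (pb_fst_hom k).
  rewrite compA lift_over /f compA -(compA (fmap Q u)) -fmap_comp Hu.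
  by rewrite -pb_hom_eq idtoKA.
pose t1 := factor (lift_opcartesian O f) Hf.
have Ht : idto (pb_eq c) ∘ fmap P t1 = fmap Q u ∘ idto (push_eq O (pb_fst a) f).
  by rewrite factor_over compA idtoKA.
exists (@PbHom (pb_push g) c t1 u Ht); split.
  by split=> //; apply: pb_hom_ext => //=; exact: factor_comp.
move=> [s1 s2 Hs] /= [es ek]; apply: pb_hom_ext => //=.
apply: (opcart_uniq (lift_opcartesian O f)); last first.
  by rewrite factor_comp -ek.
by rewrite factor_over -es compA -Hs idtoKA.
Qed.

Definition pb_opfibration : Opfibration pb_proj :=
  @Build_Opfibration pullback B pb_proj pb_push (fun _ _ _ => erefl)
    pb_lift pb_lift_over pb_lift_opcartesian.

End Pullback.

Record StrictMonoidal := {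
  mcat :> Category;
  munit : mcat;
  mtensor : Functor (prod_cat mcat mcat) mcat;
  mtensor1o : forall a, mtensor (munit, a) = a;
  mtensor1h : forall (a b : mcat) (f : a ~> b),
    idto (mtensor1o b) ∘ fmap mtensor (a := (munit, a)) (b := (munit, b)) (idc munit, f)
    = f ∘ idto (mtensor1o a);
  mtensoro1 : forall a, mtensor (a, munit) = a;
  mtensorh1 : forall (a b : mcat) (f : a ~> b),
    idto (mtensoro1 b) ∘ fmap mtensor (a := (a, munit)) (b := (b, munit)) (f, idc munit)
    = f ∘ idto (mtensoro1 a);
  mtensorAo : forall a b c, mtensor (a, mtensor (b, c)) = mtensor (mtensor (a, b), c);
  mtensorAh : forall (a b c a' b' c' : mcat) (f : a ~> a') (g : b ~> b') (h : c ~> c'),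
    idto (mtensorAo a' b' c')
      ∘ fmap mtensor (a := (a, mtensor (b, c))) (b := (a', mtensor (b', c')))
          (f, fmap mtensor (a := (b, c)) (b := (b', c')) (g, h))
    = fmap mtensor (a := (mtensor (a, b), c)) (b := (mtensor (a', b'), c'))
        (fmap mtensor (a := (a, b)) (b := (a', b')) (f, g), h)
      ∘ idto (mtensorAo a b c)
}.
Arguments munit {s} : rename.

Notation "m ⊗ n" := (mtensor _ (m, n)) (at level 40, left associativity) : cat_scope.

Record StrictAction (M : StrictMonoidal) (C : Category) := {
  act : Functor (prod_cat M C) C;
  act1o : forall x, act (munit, x) = x;
  act1h : forall (x y : C) (f : x ~> y),
    idto (act1o y) ∘ fmap act (a := (munit, x)) (b := (munit, y)) (idc munit, f)
    = f ∘ idto (act1o x);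
  actAo : forall (m n : M) x, act (m, act (n, x)) = act (m ⊗ n, x);
  actAh : forall (m n m' n' : M) (x x' : C) (u : m ~> m') (v : n ~> n') (f : x ~> x'),
    idto (actAo m' n' x')
      ∘ fmap act (a := (m, act (n, x))) (b := (m', act (n', x')))
          (u, fmap act (a := (n, x)) (b := (n', x')) (v, f))
    = fmap act (a := (m ⊗ n, x)) (b := (m' ⊗ n', x'))
        (fmap (mtensor M) (a := (m, n)) (b := (m', n')) (u, v), f)
      ∘ idto (actAo m n x)
}.
Arguments act {M C} s : rename.
Arguments act1o {M C} s x : rename.
Arguments actAo {M C} s m n x : rename.

Section OneSidedAction.
Variables (M : StrictMonoidal) (C : Category) (A : StrictAction M C).

Definition acto (m : M) (x : C) : C := act A (m, x).

Definition acth (m : M) (x y : C) (f : x ~> y) : acto m x ~> acto m y :=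
  fmap (act A) (a := (m, x)) (b := (m, y)) (idc m, f).

Lemma acth_id (m : M) (x : C) : acth m (idc x) = idc (acto m x).
Proof. exact: (fmap_id (act A) (m, x)). Qed.

Lemma acth_comp (m : M) (x y z : C) (g : y ~> z) (f : x ~> y) :
  acth m (g ∘ f) = acth m g ∘ acth m f.
Proof.
rewrite /acth -(fmap_comp (act A) (a := (m, x)) (b := (m, y)) (c := (m, z))) /=.
by rewrite comp1f.
Qed.

Lemma acth_idto (m : M) (x y : C) (e : x = y) :
  acth m (idto e) = idto (f_equal (acto m) e).
Proof. by destruct e; rewrite /= acth_id. Qed.

Lemma acth_unit (x y : C) (f : x ~> y) :
  idto (act1o A y) ∘ acth munit f = f ∘ idto (act1o A x).
Proof. exact: act1h. Qed.

Lemma acth_assoc (m n : M) (x y : C) (f : x ~> y) :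
  idto (actAo A m n y) ∘ acth m (acth n f) = acth (m ⊗ n) f ∘ idto (actAo A m n x).
Proof.
rewrite /acth (actAh A); congr (fmap _ _ ∘ _).
by rewrite (fmap_id (mtensor M) (m, n)).
Qed.

Lemma acth_eq (m n : M) (e : m = n) (x y : C) (f : x ~> y) :
  idto (f_equal (acto^~ y) e) ∘ acth m f = acth n f ∘ idto (f_equal (acto^~ x) e).
Proof. by destruct e; rewrite /= comp1f compf1. Qed.

End OneSidedAction.

Definition delooping (M : StrictMonoidal) : Category :=
  {| cob := unit; hom := fun _ _ => M; idc := fun _ => munit;
     comp := fun _ _ _ n m => n ⊗ m;
     comp1f := fun _ _ => mtensor1o (s := M); compf1 := fun _ _ => mtensoro1 (s := M);
     compA := fun _ _ _ _ p n m => esym (mtensorAo p n m) |}.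

Lemma delooping_idto (M : StrictMonoidal) (a b : delooping M) (e : a = b) :
  idto e = munit :> M.
Proof. by destruct e. Qed.

Section Para.
Variables (M : StrictMonoidal) (C : Category) (A : StrictAction M C).

Record para_hom (x y : C) := ParaHom {
  para_res : M;
  para_mor : acto A para_res x ~> y
}.

Lemma para_hom_ext (x y : C) (f g : para_hom x y) :
  (exists e : para_res f = para_res g,
     para_mor f = para_mor g ∘ idto (f_equal (acto A ^~ x) e)) -> f = g.
Proof.
by case: f g => [m f] [n g] /= [e]; destruct e; rewrite compf1 => ->.
Qed.

Lemma para_hom_inj (x y : C) (f g : para_hom x y) (e : para_res f = para_res g) :
  f = g -> para_mor f = para_mor g ∘ idto (f_equal (acto A ^~ x) e).
Proof. by move=> efg; destruct efg; rewrite idto1 compf1. Qed.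

Definition para_id (x : C) : para_hom x x :=
  @ParaHom x x munit (idto (act1o A x)).

Definition para_comp (x y z : C) (g : para_hom y z) (f : para_hom x y) : para_hom x z :=
  @ParaHom x z (para_res g ⊗ para_res f)
    (para_mor g ∘ acth A (para_res g) (para_mor f)
      ∘ idto (esym (actAo A (para_res g) (para_res f) x))).

Lemma para_comp1f (x y : C) (f : para_hom x y) : para_comp (para_id y) f = f.
Proof.
apply: para_hom_ext; exists (mtensor1o _) => /=.
by rewrite acth_unit compA idto_trans; congr (_ ∘ _); exact: idto_irr.
Qed.

Lemma para_compf1 (x y : C) (f : para_hom x y) : para_comp f (para_id x) = f.
Proof.
apply: para_hom_ext; exists (mtensoro1 _) => /=.
by rewrite acth_idto compA idto_trans; congr (_ ∘ _); exact: idto_irr.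
Qed.

Lemma para_compA (x y z w : C) (h : para_hom z w) (g : para_hom y z) (f : para_hom x y) :
  para_comp (para_comp h g) f = para_comp h (para_comp g f).
Proof.
apply: para_hom_ext; exists (esym (mtensorAo _ _ _)) => /=.
rewrite !acth_comp acth_idto !compA !idto_trans.
set n := para_res g; set k := para_res h; set m := para_res f.
have -> : idto (esym (actAo A k n y)) ∘ (acth A (k ⊗ n) (para_mor f)
            ∘ idto (esym (actAo A (k ⊗ n) m x)))
   = acth A k (acth A n (para_mor f)) ∘ (idto (esym (actAo A k n (acto A m x)))
       ∘ idto (esym (actAo A (k ⊗ n) m x))).
  rewrite -[LHS]compA -[RHS]compA; apply: comp_congl.
  rewrite -[RHS](idtoKA (actAo A k n y) (esym (actAo A k n y))) -[RHS]compA.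
  rewrite [in RHS]compA -[in RHS](compA (idto (actAo A k n y))) acth_assoc.
  by rewrite [in RHS]compA idtoK compf1.
rewrite idto_trans; do ! apply: comp_congr; exact: idto_irr.
Qed.

Definition para : Category :=
  {| cob := C; hom := para_hom; idc := para_id; comp := para_comp;
     comp1f := para_comp1f; compf1 := para_compf1; compA := para_compA |}.

Definition para_proj : Functor para (delooping M) :=
  {| fob := fun _ : para => tt : delooping M; fmap := para_res;
     fmap_id := fun _ => erefl; fmap_comp := fun _ _ _ _ _ => erefl |}.

Definition para_push (x : para) (y : delooping M) (m : para_proj x ~> y) : para :=
  acto A m x.

Definition para_push_eq (x : para) (y : delooping M) (m : para_proj x ~> y) :
  para_proj (para_push m) = y :=
  match y with tt => erefl end.

Definition para_lift (x : para) (y : delooping M) (m : para_proj x ~> y) :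
    x ~> para_push m :=
  @ParaHom x (acto A m x) m (idc (acto A m x)).

Lemma para_lift_over (x : para) (y : delooping M) (m : para_proj x ~> y) :
  idto (para_push_eq m) ∘ fmap para_proj (para_lift m) = m.
Proof. by rewrite delooping_idto; exact: mtensor1o. Qed.

Lemma para_lift_opcartesian (x : para) (y : delooping M) (m : para_proj x ~> y) :
  opcartesian para_proj (para_lift m).
Proof.
move=> c [k f] u /= Hu; destruct Hu.
exists (@ParaHom (acto A m x) c u (f ∘ idto (actAo A u m x))); split.
  split=> //; apply: para_hom_ext; exists (erefl) => /=.
  by rewrite acth_id !compf1 compA idtoK compf1.
move=> [v g] /= [ev]; destruct ev => ek.
have -> : f = g ∘ idto (esym (actAo A v m x)).
  by have /= := para_hom_inj (f := para_comp (ParaHom g) (para_lift m)) (g := ParaHom f) erefl ek; rewrite acth_id !compf1 => <-.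
by rewrite compA idtoK compf1.
Qed.

Definition para_opfibration : Opfibration para_proj :=
  @Build_Opfibration para (delooping M) para_proj para_push para_push_eq
    para_lift para_lift_over para_lift_opcartesian.

(** Every fiber of [para_proj] is a copy of [C]: the vertical morphisms
    [x ~> y] of [para] are the pairs [(m, f : m • x ~> y)] with [m = I],
    that is, the arrows [x = I • x ~> y] of [C]. *)
Definition para_of_fiber (x y : C) (f : x ~> y) : para_hom x y :=
  @ParaHom x y munit (f ∘ idto (act1o A x)).

Lemma acto_unit (m : M) (e : m = munit) (x : C) : acto A m x = x.
Proof. by rewrite e; exact: act1o. Qed.

Definition fiber_of_para (x y : C) (k : para_hom x y) (e : para_res k = munit) : x ~> y :=
  para_mor k ∘ idto (esym (acto_unit e x)).

End Para.

Section PreOptic.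
Variables (M : StrictMonoidal) (C D : Category).
Variables (A : StrictAction M C) (B : StrictAction M D).

(** The preoptics [(v, y) ⇆ (u, x)].  They are the morphisms from [(u, x)] to
    [(v, y)]: this is the direction of the updates [m ∘ u ~> v], and the one in
    which residuals compose as in [delooping M]. *)
Record preoptic_hom (p q : D * C) := PreOptic {
  residual : M;
  view : q.2 ~> acto A residual p.2;
  update : acto B residual p.1 ~> q.1
}.

Lemma preoptic_hom_ext (p q : D * C) (f g : preoptic_hom p q) :
  (exists e : residual f = residual g,
     idto (f_equal (acto A ^~ p.2) e) ∘ view f = view g /\
     update f = update g ∘ idto (f_equal (acto B ^~ p.1) e)) -> f = g.
Proof.
case: f g => [m f f'] [n g g'] /= [e]; destruct e.
by rewrite /= comp1f compf1 => -[-> ->].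
Qed.

Definition preoptic_id (p : D * C) : preoptic_hom p p :=
  @PreOptic p p munit (idto (esym (act1o A p.2))) (idto (act1o B p.1)).

Definition preoptic_comp (p q r : D * C) (g : preoptic_hom q r) (f : preoptic_hom p q) :
    preoptic_hom p r :=
  @PreOptic p r (residual g ⊗ residual f)
    (idto (actAo A (residual g) (residual f) p.2)
      ∘ acth A (residual g) (view f) ∘ view g)
    (update g ∘ acth B (residual g) (update f)
      ∘ idto (esym (actAo B (residual g) (residual f) p.1))).

Lemma preoptic_comp1f (p q : D * C) (f : preoptic_hom p q) :
  preoptic_comp (preoptic_id q) f = f.
Proof.
apply: preoptic_hom_ext; exists (mtensor1o _) => /=; split; last first.
  by rewrite acth_unit compA idto_trans; congr (_ ∘ _); exact: idto_irr.
rewrite -!compA idto_trans.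
rewrite (idto_irr _ (act1o A (acto A (residual f) p.2))) acth_unit.
by rewrite compA idtoK compf1.
Qed.

Lemma preoptic_compf1 (p q : D * C) (f : preoptic_hom p q) :
  preoptic_comp f (preoptic_id p) = f.
Proof.
apply: preoptic_hom_ext; exists (mtensoro1 _) => /=; split; last first.
  by rewrite acth_idto compA idto_trans; congr (_ ∘ _); exact: idto_irr.
by rewrite acth_idto -!compA !idto_trans idto1 comp1f.
Qed.

Lemma preoptic_compA (p q r s : D * C)
    (h : preoptic_hom r s) (g : preoptic_hom q r) (f : preoptic_hom p q) :
  preoptic_comp (preoptic_comp h g) f = preoptic_comp h (preoptic_comp g f).
Proof.
apply: preoptic_hom_ext; exists (esym (mtensorAo _ _ _)); split; last first.
  apply: (para_hom_inj (f := ParaHom _) (g := ParaHom _)).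
  exact: (para_compA (ParaHom (update h)) (ParaHom (update g)) (ParaHom (update f))).
set n := residual g; set k := residual h; set m := residual f.
rewrite /= -/n -/k -/m !acth_comp acth_idto -!compA; do 2! apply: comp_congl.
rewrite compA -acth_assoc -!compA idto_trans; apply: comp_congl.
by rewrite !idto_trans; exact: idto_irr.
Qed.

Definition preoptic : Category :=
  {| cob := D * C; hom := preoptic_hom; idc := preoptic_id; comp := preoptic_comp;
     comp1f := preoptic_comp1f; compf1 := preoptic_compf1; compA := preoptic_compA |}.

Lemma para_of_fiber_vert (x y : para A) (f : (x : C) ~> y) (e : para_proj A y = tt) :
  idto e ∘ fmap (para_proj A) (para_of_fiber A f : x ~> y) = idc (tt : delooping M).
Proof. by rewrite delooping_idto; exact: mtensor1o. Qed.

Definition view_hom (p q : preoptic) (h : p ~> q) :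
    hom (c := dual (para_opfibration A)) p.2 q.2 :=
  DualHom (O := para_opfibration A) (a := p.2) (b := q.2)
    (residual h) (para_of_fiber A (view h)) (para_of_fiber_vert _ _).

Lemma para_push_comparison (x : para A) (y z : delooping M) (n : y ~> z)
    (m : para_proj A x ~> y) :
  push_comparison (para_opfibration A) n m
  = @ParaHom _ _ A (acto A m x) (acto A (n ⊗ m) x) n (idto (actAo A n m x)).
Proof.
apply: (opcart_uniq (lift_opcartesian (para_opfibration A) m)).
  rewrite push_comparison_over !delooping_idto /=.
  by rewrite mtensoro1 mtensor1o.
rewrite push_comparison_lift; apply: para_hom_ext; exists erefl.
by rewrite /= acth_id !compf1 idtoK.
Qed.

Lemma para_push_vert (p q : preoptic) (h : p ~> q) (z : delooping M)
    (n : para_proj A q.2 ~> z) :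
  push_vert (view_hom h) n
  = para_of_fiber A (idto (actAo A n (residual h) p.2) ∘ acth A n (view h)).
Proof.
apply: (opcart_uniq (lift_opcartesian (para_opfibration A) n)).
  rewrite push_vert_over !delooping_idto /=.
  by rewrite mtensor1o.
rewrite push_vert_lift para_push_comparison.
apply: para_hom_ext; exists (etrans (mtensoro1 n) (esym (mtensor1o n))) => /=.
rewrite !acth_id !acth_comp acth_idto !compf1 !compA; do 2! apply: comp_congr.
by rewrite !idto_trans; exact: idto_irr.
Qed.

Lemma view_hom_id (p : preoptic) : view_hom (idc p) = idc _.
Proof.
apply: dual_hom_ext => [//|t tl tP].
have -> : t = idc _.
  apply: (opcart_uniq (lift_opcartesian (para_opfibration A) _)).
    by rewrite tP idtoK fmap_id.
  by rewrite comp1f.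
rewrite comp1f; apply: para_hom_ext; exists erefl.
by rewrite /= idtoK compf1.
Qed.

Lemma view_hom_comp (p q r : preoptic) (g : q ~> r) (f : p ~> q) :
  view_hom (g ∘ f) = view_hom g ∘ view_hom f.
Proof.
apply: dual_hom_ext => [//|t tl tP].
have -> : t = idc _.
  apply: (opcart_uniq (lift_opcartesian (para_opfibration A) _)).
    by rewrite tP idtoK fmap_id.
  by rewrite comp1f.
rewrite comp1f.
change (para_of_fiber A (view (g ∘ f))
  = push_vert (view_hom f) (dbase (view_hom g)) ∘ para_of_fiber A (view g)).
rewrite (para_push_vert f); apply: para_hom_ext.
exists (esym (mtensor1o _)) => /=.
rewrite acth_comp acth_idto !compA; do 2! apply: comp_congr.
by rewrite !idto_trans idto1 compf1 acth_unit.
Qed.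

Definition view_functor : Functor preoptic (dual (para_opfibration A)) :=
  {| fob := fun p : preoptic => p.2 : dual (para_opfibration A); fmap := view_hom;
     fmap_id := view_hom_id; fmap_comp := view_hom_comp |}.

Definition optic_top : Functor (pullback (para_proj B) (para_proj A)) (para A) :=
  pb_proj (para_proj B) (para_proj A).

Definition optic_top_opfibration : Opfibration optic_top :=
  pb_opfibration (para_proj A) (para_opfibration B).

Definition optic_dual : Category :=
  iter_dual optic_top_opfibration (para_opfibration A).

Definition optic_dual_top : Functor optic_dual (dual (para_opfibration A)) :=
  iter_dual_top optic_top_opfibration (para_opfibration A).

(** A morphism [phi] from [(u, x)] to [(v, y)] in the iterated dual is a pair of
    a residual [m] and a vertical morphism [(v, y) ~> m_* (u, x)] in the dual over
    [para A]; the latter is in turn a pair of a morphism [y ~> m • x] in the fiber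
    of [para_proj A], and a morphism [m ∘ u ~> v] in the fiber of [optic_top].
    The next three definitions extract these parts as arrows of [C] and [D]. *)

Definition residual_part (a b : optic_dual) (phi : a ~> b) : M := dbase phi.

Definition view_fiber (a b : optic_dual) (phi : a ~> b) :
    para_hom A (pb_snd b) (acto A (residual_part phi) (pb_snd a)) :=
  dbase (dfib phi).

Lemma view_fiber_vert (a b : optic_dual) (phi : a ~> b) :
  para_res (view_fiber phi) = munit.
Proof. by have := dfib_vert phi; rewrite delooping_idto /= mtensor1o. Qed.

Definition view_part (a b : optic_dual) (phi : a ~> b) :
    hom (c := C) (pb_snd b) (acto A (residual_part phi) (pb_snd a)) :=
  fiber_of_para (view_fiber_vert phi).

(** The source and target of the last part are the chosen lifts
    [m_* (u, x)] and [(view_fiber phi)_* (v, y)], whose first components are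
    [m ∘ u] and [I ∘ v = v] up to units of [M]. *)
Definition update_fiber (a b : optic_dual) (phi : a ~> b) :
    para_hom B
      (pb_fst (push (iter_opfibration optic_top_opfibration (para_opfibration A))
                 a (dbase phi)))
      (pb_fst (push optic_top_opfibration b (dbase (dfib phi)))) :=
  pb_fst_hom (dfib (dfib phi)).

Lemma update_fiber_vert (a b : optic_dual) (phi : a ~> b) :
  para_res (update_fiber phi) = munit.
Proof.
have e : para_res (pb_snd_hom (dfib (dfib phi))) = munit.
  have := f_equal (@para_res _ _ _ _ _) (dfib_vert (dfib phi)).
  by rewrite /= mtensor1o.
have := pb_hom_eq (dfib (dfib phi)).
by rewrite !delooping_idto /= e !mtensor1o.
Qed.

Lemma update_source (a b : optic_dual) (phi : a ~> b) :
  acto B (residual_part phi) (pb_fst a) =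
  pb_fst (push (iter_opfibration optic_top_opfibration (para_opfibration A)) a (dbase phi))
  :> D.
Proof. by rewrite /= /para_push delooping_idto mtensoro1. Qed.

Lemma update_target (a b : optic_dual) (phi : a ~> b) :
  pb_fst (push optic_top_opfibration b (dbase (dfib phi))) = pb_fst b :> D.
Proof.
rewrite /= /para_push delooping_idto mtensoro1; apply: acto_unit.
exact: (view_fiber_vert phi).
Qed.

Definition update_part (a b : optic_dual) (phi : a ~> b) :
    hom (c := D) (acto B (residual_part phi) (pb_fst a)) (pb_fst b) :=
  idto (update_target phi) ∘ fiber_of_para (update_fiber_vert phi)
    ∘ idto (update_source phi).

Definition optic_dual_proj : Functor optic_dual (delooping M) :=
  dual_proj (iter_opfibration optic_top_opfibration (para_opfibration A)).

Definition optic_dual_bottom : Functor (dual (para_opfibration A)) (delooping M) :=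
  iter_dual_bottom (para_opfibration A).

Definition optic_ob (a : optic_dual) : preoptic := (pb_fst a, pb_snd a).

Definition optic_parts (a b : optic_dual) (phi : a ~> b) : optic_ob a ~> optic_ob b :=
  @PreOptic (optic_ob a) (optic_ob b)
    (residual_part phi) (view_part phi) (update_part phi).

End PreOptic.
Arguments optic_ob {M C D A B} a.
Arguments optic_parts {M C D A B a b} phi.

(* Main.v *)
(** Arrows of the iterated dual have sources and targets that agree with those of
    preoptics only up to the equations of the strict actions, so all comparisons
    are made up to [heq], which identifies arrows along equal endpoints.  A chosen
    opcartesian lift has an identity as its component in [D], so the equations
    characterising [push_comparison] and [push_vert] show that the former is also
    an identity there, while the latter is [n ∘ -] applied to the given update.
    This yields the composition law of the updates.  The views need no such
    computation, because both [iter_dual_top] and [view_functor] are functors,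
    they agree through [optic_parts], and [view_hom] determines the view. *)

From Stdlib Require Import ProofIrrelevance IndefiniteDescription FunctionalExtensionality.
From Corelib Require Import ssreflect ssrfun.
Require Import Defs.

Set Implicit Arguments.
Unset Strict Implicit.
Unset Printing Implicit Defensive.

(** * Equality of arrows along equal endpoints *)

Inductive heq (C : Category) (a b : C) (f : a ~> b) :
    forall a' b' : C, a' ~> b' -> Prop :=
  heq_refl : heq f f.
Notation "f ≈ g" := (heq f g) (at level 70, no associativity) : cat_scope.
Local Hint Resolve heq_refl : core.

Section HeterogeneousEquality.
Variable C : Category.
Implicit Types a b c : C.

(** Proof irrelevance makes dependent pairs injective; this is used once for each endpoint. *)
Lemma heq_eq a b (f g : a ~> b) : f ≈ g -> f = g.
Proof.
move=> H; apply: (ProofIrrelevanceTheory.EqdepTheory.inj_pair2 _ (hom a)).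
apply: (ProofIrrelevanceTheory.EqdepTheory.inj_pair2 _
          (fun x => {y : C & x ~> y}) a (existT _ b f) (existT _ b g)).
by destruct H.
Qed.

Lemma eq_heq a b (f g : a ~> b) : f = g -> f ≈ g.
Proof. by move=> ->. Qed.

Lemma heq_sym a b (f : a ~> b) a' b' (f' : a' ~> b') : f ≈ f' -> f' ≈ f.
Proof. by move=> H; destruct H. Qed.

Lemma heq_trans a b (f : a ~> b) a' b' (f' : a' ~> b') a'' b'' (f'' : a'' ~> b'') :
  f ≈ f' -> f' ≈ f'' -> f ≈ f''.
Proof. by move=> H H'; destruct H'. Qed.

Lemma heq_tgt a b (f : a ~> b) a' b' (f' : a' ~> b') : f ≈ f' -> b = b'.
Proof. by move=> H; destruct H. Qed.

Lemma heq_comp a b c (g : b ~> c) (f : a ~> b) a' b' c' (g' : b' ~> c') (f' : a' ~> b') :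
  g ≈ g' -> f ≈ f' -> g ∘ f ≈ g' ∘ f'.
Proof.
move=> Hg Hf; destruct Hf.
by have e := heq_tgt Hg; destruct e; rewrite (heq_eq Hg).
Qed.

Definition is_idto a b (f : a ~> b) : Prop := exists e : a = b, f = idto e.

Lemma is_idto_idto a b (e : a = b) : is_idto (idto e).
Proof. by exists e. Qed.

Lemma is_idto_idc a : is_idto (idc a).
Proof. by exists erefl. Qed.

Lemma is_idto_eq a b (f g : a ~> b) : is_idto g -> is_idto f -> f = g.
Proof. by move=> [e ->] [e' ->]; exact: idto_irr. Qed.

Lemma heq_is_idto a b (f : a ~> b) a' b' (f' : a' ~> b') : f ≈ f' -> is_idto f' -> is_idto f.
Proof. by move=> H; destruct H. Qed.

Lemma comp_is_idtol a b c (g : b ~> c) (f : a ~> b) : is_idto g -> g ∘ f ≈ f.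
Proof. by move=> [e ->]; destruct e; rewrite comp1f. Qed.

Lemma comp_is_idtor a b c (g : b ~> c) (f : a ~> b) : is_idto f -> g ∘ f ≈ g.
Proof. by move=> [e ->]; destruct e; rewrite compf1. Qed.

Lemma idto_compl a b c (e : b = c) (f : a ~> b) : idto e ∘ f ≈ f.
Proof. exact/comp_is_idtol/is_idto_idto. Qed.

Lemma idto_compr a b c (g : b ~> c) (e : a = b) : g ∘ idto e ≈ g.
Proof. exact/comp_is_idtor/is_idto_idto. Qed.

End HeterogeneousEquality.
Arguments is_idto {C a b} f.

(** * Equality and strict invertibility of functors *)

Lemma functor_ext (C D : Category) (F G : Functor C D) :
  (forall a, F a = G a) -> (forall (a b : C) (f : a ~> b), fmap F f ≈ fmap G f) -> F = G.
Proof.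
case: F G => [F Fm Fi Fc] [G Gm Gi Gc] /= /functional_extensionality e Hm.
destruct e.
have e : Fm = Gm.
  do 3! apply: functional_extensionality_dep => ?; exact: heq_eq.
by destruct e; congr Build_Functor; exact: proof_irrelevance.
Qed.

(** The inverse picks preimages of arrows by choice; faithfulness makes this choice functorial. *)
Lemma is_isomorphism_bij (C D : Category) (F : Functor C D) (g : D -> C) :
  (forall a, g (F a) = a) -> (forall b, F (g b) = b) ->
  (forall (a b : C) (f f' : a ~> b), fmap F f = fmap F f' -> f = f') ->
  (forall (a b : C) (h : F a ~> F b), exists f : a ~> b, fmap F f = h) ->
  is_isomorphism F.
Proof.
move=> gF Fg faith full.
(* Fullness speaks only of arrows between objects [F a], so [h] is first transported along [Fg]. *)
have pre (x y : D) (h : x ~> y) : exists f : g x ~> g y, fmap F f ≈ h.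
  have [f Hf] := full (g x) (g y) (idto (esym (Fg y)) ∘ h ∘ idto (Fg x)).
  exists f; rewrite Hf; apply: heq_trans (idto_compr _ _) _; exact: idto_compl.
pose G0 x y (h : x ~> y) := constructive_indefinite_description _ (pre x y h).
pose Gm x y (h : x ~> y) := proj1_sig (G0 x y h).
have GmP x y (h : x ~> y) : fmap F (Gm x y h) ≈ h := proj2_sig (G0 x y h).
have G1 x : Gm x x (idc x) = idc (g x).
  apply: faith; apply: heq_eq; apply: heq_trans (GmP _ _ _) _.
  by rewrite fmap_id Fg.
have G2 x y z (k : y ~> z) (h : x ~> y) : Gm x z (k ∘ h) = Gm y z k ∘ Gm x y h.
  apply: faith; apply: heq_eq; apply: heq_trans (GmP _ _ _) _.
  by rewrite fmap_comp; apply/heq_sym/heq_comp; exact: GmP.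
exists (Build_Functor G1 G2); split; apply: functor_ext => //= a b f.
(* [g (F a)] equals [a] only propositionally, so faithfulness is needed along equal endpoints. *)
have faith' (a' b' : C) (f' : a' ~> b') : a = a' -> b = b' -> fmap F f ≈ fmap F f' -> f ≈ f'.
  by move=> ea eb; destruct ea, eb => /heq_eq/faith ->.
by apply/heq_sym/faith' => //; apply/heq_sym/GmP.
Qed.

(** * Actions and [para] up to [heq] *)

Section ActionLemmas.
Variables (M : StrictMonoidal) (C : Category) (A : StrictAction M C).

Lemma acth_heq (m m' : M) (x y x' y' : C) (f : x ~> y) (f' : x' ~> y') :
  m = m' -> f ≈ f' -> acth A m f ≈ acth A m' f'.
Proof. by move=> -> H; destruct H. Qed.

Lemma acth_munit (m : M) (x y : C) (f : x ~> y) : m = munit -> acth A m f ≈ f.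
Proof.
move=> ->; apply: heq_trans (heq_sym (idto_compl (act1o A y) _)) _.
rewrite acth_unit; exact: idto_compr.
Qed.

Lemma acth_is_idto (m : M) (x y : C) (f : x ~> y) : is_idto f -> is_idto (acth A m f).
Proof. by move=> [e ->]; rewrite acth_idto; exact: is_idto_idto. Qed.

Lemma para_hom_eq (x y : C) (k k' : para_hom A x y) :
  para_res k = para_res k' -> para_mor k ≈ para_mor k' -> k = k'.
Proof.
case: k k' => [m f] [m' f'] /= e; destruct e => /heq_eq -> //.
Qed.

Lemma para_mor_heq (x y : C) (k k' : para_hom A x y) : k = k' -> para_mor k ≈ para_mor k'.
Proof. by move=> ->. Qed.

Lemma para_mor_comp (x y z : C) (g : para_hom A y z) (f : para_hom A x y) :
  para_mor (para_comp g f) ≈ para_mor g ∘ acth A (para_res g) (para_mor f).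
Proof. exact: idto_compr. Qed.

Lemma para_mor_comp_idto (x y z : C) (g : para_hom A y z) (f : para_hom A x y) :
  is_idto (para_mor f) -> para_mor (para_comp g f) ≈ para_mor g.
Proof.
move=> Hf; apply: heq_trans (para_mor_comp _ _) _.
exact/comp_is_idtor/acth_is_idto.
Qed.

Lemma para_mor_idto_comp (x y z : C) (g : para_hom A y z) (f : para_hom A x y) :
  is_idto (para_mor g) ->
  para_mor (para_comp g f) ≈ acth A (para_res g) (para_mor f).
Proof.
move=> Hg; apply: heq_trans (para_mor_comp _ _) _; exact: comp_is_idtol.
Qed.

(** A unit residual acts trivially, so composing with a vertical arrow is composition in [C]. *)
Lemma para_mor_comp_vert (x y z : C) (g : para_hom A y z) (f : para_hom A x y)
    (x' y' z' : C) (G : y' ~> z') (F : x' ~> y') :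
  para_res g = munit -> para_mor g ≈ G -> para_mor f ≈ F ->
  para_mor (para_comp g f) ≈ G ∘ F.
Proof.
move=> rg HG HF; apply: heq_trans (para_mor_comp _ _) _.
apply: heq_comp => //; apply: heq_trans HF; exact: acth_munit.
Qed.

Lemma fiber_of_para_heq (x y : C) (k : para_hom A x y) (e : para_res k = munit) :
  fiber_of_para e ≈ para_mor k.
Proof. exact: idto_compr. Qed.

Lemma para_of_fiber_heq (x y : C) (f : x ~> y) : para_mor (para_of_fiber A f) ≈ f.
Proof. exact: idto_compr. Qed.

End ActionLemmas.

(** * Updates in the dual of the top opfibration *)

Section OpticTop.
Variables (M : StrictMonoidal) (C D : Category).
Variables (A : StrictAction M C) (B : StrictAction M D).

Local Notation Q := (optic_top A B).
Local Notation OQ := (optic_top_opfibration A B).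
Local Notation OP := (para_opfibration A).
Local Notation OI := (iter_opfibration OQ OP).
Local Notation pbB := (pullback (para_proj B) (para_proj A)).

(** Transports in [delooping M] are the unit, so the pullback condition compares just the
    residuals. *)
Lemma para_res_pb_fst (a b : pbB) (h : a ~> b) :
  para_res (pb_fst_hom h) = para_res (pb_snd_hom h).
Proof.
by have := pb_hom_eq h; rewrite !delooping_idto /= mtensor1o mtensoro1.
Qed.

Lemma top_lift_idto (a : pbB) (y : para A) (f : Q a ~> y) :
  is_idto (para_mor (pb_fst_hom (lift OQ a f))).
Proof. exact: is_idto_idc. Qed.

Lemma top_push_comparison_res (a : pbB) (y z : para A) (g : y ~> z) (f : Q a ~> y) :
  para_res (pb_fst_hom (push_comparison OQ g f)) = para_res g.
Proof.
rewrite para_res_pb_fst.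
have := f_equal (@para_res _ _ _ _ _) (push_comparison_over OQ g f).
by rewrite /= mtensor1o mtensoro1.
Qed.

Lemma top_push_comparison_idto (a : pbB) (y z : para A) (g : y ~> z) (f : Q a ~> y) :
  is_idto (para_mor (pb_fst_hom (push_comparison OQ g f))).
Proof.
have e := f_equal (@pb_fst_hom _ _ _ _ _ _ _) (push_comparison_lift OQ g f).
apply: heq_is_idto (top_lift_idto (g ∘ f)).
apply: heq_trans (para_mor_heq e).
exact/heq_sym/para_mor_comp_idto/top_lift_idto.
Qed.

(** A morphism [a ~> b] of the dual of [optic_top] is a morphism [k • x ~> y] of
    [C] together with [top_update : v ~> k ∘ u] in [D], up to units of [M],
    where [a = (u, x)] and [b = (v, y)]. *)
Definition top_update (a b : dual OQ) (p : a ~> b) := para_mor (pb_fst_hom (dfib p)).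

Lemma top_update_heq (a b : dual OQ) (p q : a ~> b) : p = q -> top_update p ≈ top_update q.
Proof. by move=> ->; exact: heq_refl. Qed.

Lemma top_push_vert_res (a b : dual OQ) (p : a ~> b) (z : para A) (g : Q b ~> z) :
  para_res (pb_fst_hom (push_vert p g)) = munit.
Proof.
rewrite para_res_pb_fst.
have := f_equal (@para_res _ _ _ _ _) (push_vert_over p g).
by rewrite /= mtensor1o.
Qed.

(** In [push_vert_lift], the lift on the left and the comparison on the right are identities in [D];
    what remains is the residual of [g] acting on the update. *)
Lemma top_push_vert_heq (a b : dual OQ) (p : a ~> b) (z : para A) (g : Q b ~> z) :
  para_mor (pb_fst_hom (push_vert p g)) ≈ acth B (para_res g) (top_update p).
Proof.
have e := f_equal (@pb_fst_hom _ _ _ _ _ _ _) (push_vert_lift p g).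
apply: heq_trans (heq_trans (para_mor_heq e) _).
  exact/heq_sym/para_mor_comp_idto/top_lift_idto.
apply: heq_trans (para_mor_idto_comp _ _) _; first exact: top_push_comparison_idto.
by rewrite top_push_comparison_res; exact: heq_refl.
Qed.

(** The order is reversed because fibers of the dual are opposite; a unit residual makes the
    reindexing trivial. *)
Lemma top_update_comp_vert (a b c : dual OQ) (q : b ~> c) (p : a ~> b)
    (x y z : D) (F : x ~> y) (G : z ~> x) :
  para_res (dbase q) = munit -> top_update p ≈ F -> top_update q ≈ G ->
  top_update (q ∘ p) ≈ F ∘ G.
Proof.
move=> rq HF HG.
apply: (para_mor_comp_vert (g := pb_fst_hom (push_vert p (dbase q)))) HG.
  exact: top_push_vert_res.
apply: heq_trans (top_push_vert_heq p (dbase q)) _.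
by apply: heq_trans (acth_munit _ _ rq) HF.
Qed.

Lemma top_update_idto_comp (a b c : dual OQ) (q : b ~> c) (p : a ~> b) :
  is_idto (top_update q) -> top_update (q ∘ p) ≈ acth B (para_res (dbase q)) (top_update p).
Proof.
move=> Hq; apply: heq_trans (top_push_vert_heq p (dbase q)).
exact: (para_mor_comp_idto (pb_fst_hom (push_vert p (dbase q)))).
Qed.

Lemma top_update_comp_idto (a b c : dual OQ) (q : b ~> c) (p : a ~> b) :
  is_idto (top_update p) -> top_update (q ∘ p) ≈ top_update q.
Proof.
move=> Hp; apply: heq_trans (para_mor_idto_comp (g := pb_fst_hom (push_vert p (dbase q))) _ _) _.
  apply: heq_is_idto (top_push_vert_heq p (dbase q)) _.
  exact: acth_is_idto.
apply: acth_munit; exact: top_push_vert_res.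
Qed.

End OpticTop.

(** * Residual, view and update in the iterated dual *)

Section OpticDual.
Variables (M : StrictMonoidal) (C D : Category).
Variables (A : StrictAction M C) (B : StrictAction M D).

Local Notation OQ := (optic_top_opfibration A B).
Local Notation OP := (para_opfibration A).
Local Notation OI := (iter_opfibration OQ OP).
Local Notation pbB := (pullback (para_proj B) (para_proj A)).
Local Notation P2 := (para_proj A ∘F dual_proj OQ).

(** The chosen lift is a [dual_lift], whose fiber component is a [push_comparison] of the top
    opfibration. *)
Lemma iter_lift_idto (a : dual OQ) (y : delooping M) (m : P2 a ~> y) :
  is_idto (top_update (lift OI a m)).
Proof. exact: top_push_comparison_idto. Qed.

Lemma iter_push_comparison_res (a : dual OQ) (y z : delooping M) (n : y ~> z)
    (m : P2 a ~> y) :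
  para_res (dbase (push_comparison OI n m)) = n.
Proof.
have := push_comparison_over OI n m.
by rewrite !delooping_idto /= mtensor1o mtensoro1.
Qed.

Lemma iter_push_comparison_idto (a : dual OQ) (y z : delooping M) (n : y ~> z)
    (m : P2 a ~> y) :
  is_idto (top_update (push_comparison OI n m)).
Proof.
apply: heq_is_idto (iter_lift_idto (n ∘ m)).
apply: heq_trans (top_update_heq (push_comparison_lift OI n m)).
exact/heq_sym/top_update_comp_idto/iter_lift_idto.
Qed.

Lemma iter_push_vert_res (a b : optic_dual A B) (phi : a ~> b) (z : delooping M)
    (n : P2 b ~> z) :
  para_res (dbase (push_vert phi n)) = munit.
Proof.
have := push_vert_over phi n.
by rewrite !delooping_idto /= mtensor1o.
Qed.

Lemma iter_push_vert_update (a b : optic_dual A B) (phi : a ~> b) (z : delooping M)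
    (n : P2 b ~> z) :
  top_update (push_vert phi n) ≈ acth B n (top_update (dfib phi)).
Proof.
apply: heq_trans (heq_sym (top_update_comp_idto _ (iter_lift_idto n))) _.
apply: heq_trans (top_update_heq (push_vert_lift phi n)) _.
apply: heq_trans (top_update_idto_comp _ (iter_push_comparison_idto _ _)) _.
by rewrite iter_push_comparison_res; exact: heq_refl.
Qed.

Lemma update_part_heq (a b : optic_dual A B) (phi : a ~> b) :
  update_part phi ≈ top_update (dfib phi).
Proof.
apply: heq_trans (idto_compr _ _) _; apply: heq_trans (idto_compl _ _) _.
exact: fiber_of_para_heq.
Qed.

(** The second dualization undoes the reversal of the first, so updates compose in their original
    order. *)
Lemma update_part_comp (a b c : optic_dual A B) (psi : b ~> c) (phi : a ~> b) :
  update_part (psi ∘ phi) ≈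
  update_part psi ∘ acth B (residual_part psi) (update_part phi).
Proof.
apply: heq_trans (update_part_heq _) _.
apply: (top_update_comp_vert (iter_push_vert_res phi (dbase psi))).
  exact/heq_sym/update_part_heq.
apply: heq_trans (iter_push_vert_update phi (dbase psi)) _.
exact/acth_heq/heq_sym/update_part_heq.
Qed.

Lemma update_part_id (a : optic_dual A B) : is_idto (update_part (idc a)).
Proof.
apply: heq_is_idto (update_part_heq _) _; exact: iter_lift_idto.
Qed.

Lemma view_part_heq (a b : optic_dual A B) (phi : a ~> b) :
  view_part phi ≈ para_mor (view_fiber phi).
Proof. exact: fiber_of_para_heq. Qed.

(** The lifts of the composite opfibration are built on those of [para_opfibration A], so
    [dual_proj] preserves the chosen lifts strictly. *)
Lemma iter_map_push (a : dual OQ) (y : delooping M) (m : P2 a ~> y) :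
  map_push OI OP (comp_opfibration_map (dual_opfibration OQ) OP) m = idc _.
Proof.
apply: (opcart_uniq (lift_opcartesian OP m)).
  rewrite fmap_id.
  exact: etrans (map_push_over OI OP (comp_opfibration_map (dual_opfibration OQ) OP) (a := a) m) (idtoK _ _).
have H := map_push_lift OI OP (comp_opfibration_map (dual_opfibration OQ) OP) (a := a) m.
rewrite comp1f -[RHS]H; apply: comp_congr.
(* The base of the [dual_lift] is the lift in [para A] followed by a trivial transport, since
   [push_eq] is [erefl] in the pullback. *)
exact/esym/comp1f.
Qed.

Lemma view_hom_parts (a b : optic_dual A B) (phi : a ~> b) :
  view_hom (optic_parts phi) = fmap (optic_dual_top A B) phi.
Proof.
apply: dual_hom_ext => [//|t tl tP].
(* The bases agree definitionally, so the transport [t] is the identity by uniqueness of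
   factorizations. *)
have -> : t = idc _.
  apply: (opcart_uniq (lift_opcartesian OP _)); first by rewrite tP idtoK fmap_id.
  by rewrite comp1f.
rewrite comp1f /= iter_map_push.
rewrite [RHS](@comp1f (para A)).
apply: para_hom_eq; first by rewrite /= (view_fiber_vert phi).
apply: heq_trans (para_of_fiber_heq _ _) _; exact: view_part_heq.
Qed.

(** The targets of the views depend on the two residuals, hence the conclusion up to [heq]. *)
Lemma view_hom_inj (p q : preoptic A B) (h h' : p ~> q) :
  view_hom h = view_hom h' -> view h ≈ view h'.
Proof.
move=> e; apply: heq_trans (heq_sym (para_of_fiber_heq A _)) _.
apply: heq_trans (para_of_fiber_heq A _).
change (para_mor (dfib (view_hom h)) ≈ para_mor (dfib (view_hom h'))).
by rewrite e; exact: heq_refl.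
Qed.

Lemma preoptic_hom_eq (p q : preoptic A B) (f g : p ~> q) :
  residual f = residual g -> view f ≈ view g -> update f ≈ update g -> f = g.
Proof.
case: f g => [m v u] [m' v' u'] /= e; destruct e.
by move=> /heq_eq -> /heq_eq ->.
Qed.

Lemma optic_parts_id (a : optic_dual A B) : optic_parts (idc a) = idc (optic_ob a).
Proof.
apply: preoptic_hom_eq => //.
  by apply: view_hom_inj; rewrite view_hom_parts view_hom_id fmap_id.
apply: eq_heq; apply: is_idto_eq (update_part_id a); exact: is_idto_idto.
Qed.

Lemma optic_parts_comp (a b c : optic_dual A B) (g : b ~> c) (f : a ~> b) :
  optic_parts (g ∘ f) = optic_parts g ∘ optic_parts f.
Proof.
apply: preoptic_hom_eq => //.
  by apply: view_hom_inj; rewrite view_hom_comp !view_hom_parts fmap_comp.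
apply: heq_trans (update_part_comp g f) _.
exact/heq_sym/idto_compr.
Qed.

Lemma optic_parts_inj (a b : optic_dual A B) (f g : a ~> b) :
  optic_parts f = optic_parts g -> f = g.
Proof.
move=> e.
have er : dbase f = dbase g := f_equal (@residual _ _ _ _ _ _ _) e.
have ev : para_mor (view_fiber f) ≈ para_mor (view_fiber g).
  apply: heq_trans (heq_sym (view_part_heq f)) _.
  apply: heq_trans (view_part_heq g).
  change (view (optic_parts f) ≈ view (optic_parts g)).
  by rewrite e; exact: heq_refl.
have eu : top_update (dfib f) ≈ top_update (dfib g).
  apply: heq_trans (heq_sym (update_part_heq f)) _.
  apply: heq_trans (update_part_heq g).
  change (update (optic_parts f) ≈ update (optic_parts g)).
  by rewrite e; exact: heq_refl.
(* Verticality forces unit residuals in both fibers, so the arrows of [C] and [D] determine the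
   fiber parts. *)
have rv := etrans (view_fiber_vert f) (esym (view_fiber_vert g)).
have ru := etrans (update_fiber_vert f) (esym (update_fiber_vert g)).
clear e; destruct f as [m p Hp], g as [m' p' Hp']; simpl in er; destruct er.
suff e : p = p' by destruct e; rewrite (proof_irrelevance _ Hp Hp').
rewrite /view_fiber /update_fiber /= in rv ru ev eu.
have e := para_hom_eq rv ev; clear rv ev Hp Hp'.
destruct p as [v h Hh], p' as [v' h' Hh']; simpl in e; destruct e.
suff e : h = h' by destruct e; rewrite (proof_irrelevance _ Hh Hh').
apply: pb_hom_ext; first exact: para_hom_eq ru eu.
(* The component in [para A] is an identity by verticality. *)
by rewrite -[LHS]comp1f -[RHS]comp1f; exact: etrans Hh (esym Hh').
Qed.

Lemma optic_parts_surj (a b : optic_dual A B) (h : optic_ob a ~> optic_ob b) :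
  exists f : a ~> b, optic_parts f = h.
Proof.
case: h => [m v u].
pose V : hom (c := para A) (pb_snd b) (acto A m (pb_snd a)) := para_of_fiber A v.
(* The innermost arrow must join the chosen lifts [s], over [m], and [t], over [V], so [u] is
   transported to their components in [D]. *)
pose s : pbB := push OI a (m : P2 a ~> (tt : delooping M)).
pose t : pbB := push OQ b V.
have es : pb_fst s = acto B m (pb_fst a) :> D.
  by rewrite /= /para_push delooping_idto mtensoro1.
have et : pb_fst b = pb_fst t :> D.
  by rewrite /= /para_push delooping_idto mtensoro1; exact/esym/act1o.
pose u' : hom (c := D) (pb_fst s) (pb_fst t) := idto et ∘ u ∘ idto es.
have Hu : idto (pb_eq t) ∘ fmap (para_proj B) (para_of_fiber B u' : pb_fst s ~> pb_fst t)
        = fmap (para_proj A) (idc (pb_snd s)) ∘ idto (pb_eq s).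
  (* Both sides become the tensor of two units. *)
  by rewrite !delooping_idto.
pose h : s ~> t := @PbHom _ _ _ (para_proj B) (para_proj A) s t (para_of_fiber B u') (idc _) Hu.
have Hh : idto (push_eq OQ b V) ∘ fmap (optic_top A B) h = idc _ by rewrite comp1f.
pose p : hom (c := dual OQ) b s := DualHom (O := OQ) (a := b) (b := s) V h Hh.
have Hp : idto (push_eq OI a (m : P2 a ~> (tt : delooping M))) ∘ fmap P2 p = idc _.
  by rewrite delooping_idto; exact: mtensor1o.
exists (DualHom (O := OI) (a := a) (b := b) m p Hp).
apply: preoptic_hom_eq => //.
  apply: heq_trans (view_part_heq _) _; exact: para_of_fiber_heq.
apply: heq_trans (update_part_heq _) _.
apply: heq_trans (para_of_fiber_heq B _) _.
apply: heq_trans (idto_compr _ _) _; exact: idto_compl.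
Qed.

End OpticDual.

Theorem mainTheorem3 (M : StrictMonoidal) (C D : Category)
    (A : StrictAction M C) (B : StrictAction M D) :
  exists (parts_id : forall a : optic_dual A B, optic_parts (idc a) = idc (optic_ob a))
         (parts_comp : forall (a b c : optic_dual A B) (g : b ~> c) (f : a ~> b),
            optic_parts (g ∘ f) = optic_parts g ∘ optic_parts f),
  let parts : Functor (optic_dual A B) (preoptic A B) :=
    {| fob := optic_ob;
       fmap := @optic_parts M C D A B;
       fmap_id := parts_id;
       fmap_comp := parts_comp |} in
  is_isomorphism parts
  /\ view_functor A B ∘F parts = optic_dual_top A B
  /\ optic_dual_bottom A ∘F view_functor A B ∘F parts = optic_dual_proj A B.
Proof.
exists (@optic_parts_id M C D A B), (@optic_parts_comp M C D A B) => parts.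
split; last split.
(* The equation in a pullback object lives in a one-object category, so [erefl] supplies it. *)
- pose g (p : preoptic A B) : optic_dual A B :=
    @PbOb _ _ _ (para_proj B) (para_proj A) p.1 p.2 erefl.
  apply: (is_isomorphism_bij (g := g)).
  + by move=> [u x e]; rewrite /g /= (proof_irrelevance _ e erefl).
  + by move=> [u x].
  + exact: optic_parts_inj.
  + exact: optic_parts_surj.
- by apply: functor_ext => // a b f; exact: eq_heq (view_hom_parts f).
(* Both functors send an arrow to its residual by computation. *)
- by apply: functor_ext => // a b f; exact: heq_refl.
Qed.
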